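(* Let $Q$ be an $m$-vertex symmetric directed connected graph with multiple edges, and let $p$ be the maximum of the entries of the adjacency matrix of $Q$. Then: (i) Every symmetric directed graph $G$ with no multiple edges such that $Q=G/\bowtie$ for some balanced equivalence relation $\bowtie$ on the vertices of $G$ has $mr$ vertices for some integer $r\geq p$. (ii) For every integer $r\geq p$ there exists a symmetric directed graph $G$ with no multiple edges and with $mr$ vertices, such that $Q=G/\bowtie$ for some balanced equivalence relation $\bowtie$ on the vertices of $G$.
   Context: Directed graphs are finite and may have loops and multiple edges. The adjacency matrix of a directed graph with vertices $1,\ldots,n$ is the $n\times n$ matrix of non-negative integers whose $(i,j)$ entry is the number of directed edges from vertex $j$ to vertex $i$. A directed graph is symmetric (bidirected) if its adjacency matrix is symmetric. A graph has no multiple edges if all entries of its adjacency matrix are $0$ or $1$ (single loops are allowed); it has multiple edges otherwise. A symmetric directed graph is connected if any two of its vertices are joined by a path of edges. An equivalence relation $\bowtie$ on the vertex set of a directed graph $G$ is balanced if, for any two vertices $u,v$ in the same $\bowtie$-class and any $\bowtie$-class $C$, the number of directed edges from vertices of $C$ to $u$ equals the number of directed edges from vertices of $C$ to $v$. For a balanced $\bowtie$ with classes $I_1,\ldots,I_m$, the quotient graph $G/\bowtie$ has one vertex for each class, and its edges are the projections of the edges of $G$: its adjacency matrix $[q_{ij}]_{m\times m}$ is given by letting $q_{ij}$ be the number of directed edges of $G$ from vertices of $I_j$ to any given vertex of $I_i$ (well defined since $\bowtie$ is balanced). The equality $Q=G/\bowtie$ is understood under some labelling of the classes by the vertices of $Q$;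 such a $G$ is called a lift of $Q$. *)

(* Defs.v *)
From HB Require Import structures.
From mathcomp Require Import all_boot all_order all_algebra.

Set Implicit Arguments.
Unset Strict Implicit.
Unset Printing Implicit Defensive.

Local Open Scope nat_scope.

Record digraph (n : nat) := Digraph {
  edge : finType;
  source : edge -> 'I_n;
  target : edge -> 'I_n
}.

Section Digraph.
Variables (n : nat) (G : digraph n).

(* Row index = target, column index = source. *)
Definition adjmx : 'M[nat]_n :=
  (\matrix_(i, j) #|[set e : edge G | (source e == j) && (target e == i)]|)%R.

Definition symmetric_digraph : Prop := (adjmx^T = adjmx)%R.

Definition has_multiple_edges : Prop := exists i j, 1 < adjmx i j.

Definition no_multiple_edges : Prop := ~ has_multiple_edges.

Definition edge_rel : rel 'I_n :=
  [rel u v | [exists e : edge G, (source e == u) && (target e == v)]].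

(* Directed paths are used; for symmetric digraphs, the only ones to which this
   is applied, they join the same vertices as undirected paths. *)
Definition connected_digraph : Prop := forall u v, connect edge_rel u v.

Definition max_multiplicity : nat := \max_(i < n) \max_(j < n) adjmx i j.

Definition num_edges_from (C : {set 'I_n}) (u : 'I_n) : nat :=
  #|[set e : edge G | (source e \in C) && (target e == u)]|.

Definition classes_of (R : rel 'I_n) : {set {set 'I_n}} :=
  equivalence_partition R [set: 'I_n].

Definition balanced (R : rel 'I_n) : Prop :=
  equivalence_rel R /\
  forall u v, R u v -> forall C, C \in classes_of R ->
    num_edges_from C u = num_edges_from C v.

End Digraph.

(* [is_quotient Q G R] is Q = G/R: I labels the classes of R by the vertices of
   Q, without repetition. For balanced R the count does not depend on the
   choice of u in I i. *)
Definition is_quotient (m n : nat) (Q : digraph m) (G : digraph n)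
    (R : rel 'I_n) : Prop :=
  exists I : 'I_m -> {set 'I_n},
    [/\ injective I,
        [set I i | i : 'I_m] = classes_of R &
        forall i j u, u \in I i -> adjmx Q i j = num_edges_from G (I j) u].

Definition is_lift (m n : nat) (Q : digraph m) (G : digraph n) : Prop :=
  exists2 R : rel 'I_n, balanced G R & is_quotient Q G R.

(* Main.v *)
Require Import Defs.
From mathcomp Require Import all_boot all_order all_algebra.

(** For (i), double counting the edges of [G] between two classes [I i] and
    [I j] gives [#|I i| * q i j = #|I j| * q j i]; as [Q] is symmetric, adjacent
    classes have equal size, hence by connectedness all classes have a common
    size [r]. Without multiple edges, a vertex of [I i] receives at most
    [#|I j| = r] edges from [I j], so [q i j <= r].

    For (ii), the vertices are the pairs (i, a) with [a] in Z/r, and (j, b) is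
    joined to (i, a) when the representative of [a + b] in [0, r) is less than
    [q i j]. This is symmetric, and for fixed [a] exactly [q i j] values of [b]
    satisfy it because translation by [a] is a bijection of Z/r. *)

Set Implicit Arguments.
Unset Strict Implicit.
Unset Printing Implicit Defensive.

Section Digraph.
Variables (n : nat) (G : digraph n).
Implicit Types (u v : 'I_n) (A B C : {set 'I_n}).

Lemma num_edges_from_sum C u :
  num_edges_from G C u = \sum_(v in C) adjmx G u v.
Proof.
rewrite /num_edges_from -sum1_card (partition_big (@source n G) (mem C)) /=.
  apply: eq_bigr => v vC; rewrite mxE -sum1_card; apply: eq_bigl => e.
  rewrite !inE andbC; case: eqP => [->|]; rewrite ?vC //.
by move=> e; rewrite inE => /andP[].
Qed.

Lemma symmetric_adjmxC u v : symmetric_digraph G -> adjmx G u v = adjmx G v u.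
Proof. by move=> Gsym; rewrite -{1}Gsym mxE. Qed.

Lemma adjmx_gt0 u v : (0 < adjmx G u v) = edge_rel G v u.
Proof.
rewrite mxE card_gt0; apply/set0Pn/existsP => -[e].
  by rewrite inE; exists e.
by exists e; rewrite inE.
Qed.

Lemma double_count_edges A B (a b : nat) :
    symmetric_digraph G ->
    {in A, forall u, num_edges_from G B u = a} ->
    {in B, forall u, num_edges_from G A u = b} ->
  #|A| * a = #|B| * b.
Proof.
move=> Gsym HA HB; rewrite -!sum_nat_const.
transitivity (\sum_(u in A) \sum_(v in B) adjmx G u v).
  by apply: eq_bigr => u uA; rewrite -num_edges_from_sum HA.
transitivity (\sum_(v in B) \sum_(u in A) adjmx G v u); last first.
  by apply: eq_bigr => v vB; rewrite -num_edges_from_sum HB.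
rewrite exchange_big /=; apply: eq_bigr => v _; apply: eq_bigr => u _.
exact: symmetric_adjmxC.
Qed.

Lemma num_edges_from_le_card C u :
  no_multiple_edges G -> num_edges_from G C u <= #|C|.
Proof.
move=> Gsimple; rewrite num_edges_from_sum -sum1_card; apply: leq_sum => v _.
by rewrite leqNgt; apply/negP => uv; apply: Gsimple; exists u, v.
Qed.

Lemma adjmx_le_max_multiplicity u v : adjmx G u v <= max_multiplicity G.
Proof.
apply: leq_trans (leq_bigmax u); exact: (leq_bigmax v).
Qed.

Lemma classes_of_partition (R : rel 'I_n) :
  equivalence_rel R -> partition (classes_of R) [set: 'I_n].
Proof. by move=> eqR; apply/equivalence_partitionP => x y z _ _ _; apply: eqR. Qed.

(** The level set of [f] through [u] is closed under [edge_rel], so by connectedness it contains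
    every vertex. *)
Lemma connected_const (T : eqType) (f : 'I_n -> T) :
    connected_digraph G ->
    (forall u v, edge_rel G u v -> f u = f v) ->
  forall u v, f u = f v.
Proof.
move=> Gconn fE u v; apply/eqP.
have cl : closed (edge_rel G) [pred w | f u == f w].
  by move=> x y xy; rewrite !inE (fE x y xy).
by have:= closed_connect cl (Gconn u v); rewrite !inE eqxx => <-.
Qed.

End Digraph.

Section LiftSize.
Variables (m n : nat) (Q : digraph m) (G : digraph n).
Hypotheses (Qsym : symmetric_digraph Q) (Qconn : connected_digraph Q).
Hypotheses (Gsym : symmetric_digraph G) (Gsimple : no_multiple_edges G).

Lemma lift_size : 0 < m -> is_lift Q G ->
  exists r : nat, max_multiplicity Q <= r /\ n = m * r.
Proof.
move=> m_gt0 [R [eqR _] [I [injI imI QI]]].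
have partR := classes_of_partition eqR.
have edge_card i j : edge_rel Q i j -> #|I i| = #|I j|.
  (* Multiplying by the positive entry [adjmx Q j i] turns the goal into the double count with
     [a = b]; the two counts agree by symmetry of [Q]. *)
  rewrite -adjmx_gt0 => q_gt0; apply/eqP; rewrite -(eqn_pmul2r q_gt0); apply/eqP.
  apply: double_count_edges Gsym _ _ => u uI; last by rewrite -(QI _ _ _ uI).
  by rewrite -(QI _ _ _ uI) symmetric_adjmxC.
have cardI := connected_const (f := fun i => #|I i|) Qconn edge_card.
exists #|I (Ordinal m_gt0)|; split.
  apply/bigmax_leqP => i _; apply/bigmax_leqP => j _.
  (* An entry of [Q] is an edge count only at an actual vertex of [I i]; one exists because a
     partition has no empty block. *)
  have [u uI] : exists u, u \in I i.
    apply/set0Pn; apply: contraTneq partR => I0.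
    by rewrite /partition -imI -I0 imset_f ?andbF.
  by rewrite (QI _ _ _ uI) (cardI _ j) num_edges_from_le_card.
rewrite -[LHS]card_ord -cardsT (card_partition partR) -imI big_imset /=.
  by under eq_bigr => i _ do rewrite (cardI i (Ordinal m_gt0)); rewrite sum_nat_const card_ord.
by move=> i j _ _; apply: injI.
Qed.

End LiftSize.

Section RelDigraph.
Variables (n : nat) (e : rel 'I_n).

Definition rel_digraph : digraph n :=
  @Digraph n {p : 'I_n * 'I_n | e p.1 p.2} (fun p => (val p).1) (fun p => (val p).2).

Lemma adjmx_rel_digraph u v : adjmx rel_digraph u v = e v u.
Proof.
rewrite mxE; case: (boolP (e v u)) => evu /=.
  rewrite -(cards1 (exist _ (v, u) evu : edge rel_digraph)); apply: eq_card => p.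
  by case: p => -[x y] exy; rewrite !inE -val_eqE.
apply: eq_card0 => -[[x y] /= exy]; rewrite !inE /=.
by apply: contraNF evu => /andP[/eqP <- /eqP <-].
Qed.

Lemma rel_digraph_no_multiple_edges : no_multiple_edges rel_digraph.
Proof. by case=> u [v]; rewrite adjmx_rel_digraph; case: (e v u). Qed.

Lemma rel_digraph_symmetric : symmetric e -> symmetric_digraph rel_digraph.
Proof. by move=> eC; apply/matrixP => u v; rewrite mxE !adjmx_rel_digraph eC. Qed.

Lemma num_edges_from_rel_digraph C u :
  num_edges_from rel_digraph C u = #|[set v in C | e v u]|.
Proof.
rewrite num_edges_from_sum -sum1_card.
under eq_bigr => v _ do rewrite adjmx_rel_digraph.
by rewrite -big_mkcondr; apply: eq_bigl => v; rewrite inE.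
Qed.

End RelDigraph.

(** The relation is the kernel of [f], whose classes are the fibres. Surjectivity makes the fibres
    nonempty, hence distinct for distinct labels; balance holds because the counts depend on [u]
    only through [f u]. *)
Lemma fibration_is_lift (m n : nat) (Q : digraph m) (G : digraph n)
    (f : 'I_n -> 'I_m) :
    (forall i, exists u, f u = i) ->
    (forall j u, num_edges_from G [set v | f v == j] u = adjmx Q (f u) j) ->
  is_lift Q G.
Proof.
move=> fsurj fG; pose R := [rel u v | f u == f v].
have imR : [set [set v | f v == i] | i : 'I_m] = classes_of R.
  apply/setP => A; apply/imsetP/imsetP => [[i _ ->]|[u _ ->]].
    have [u <-] := fsurj i; exists u => //.
    by apply/setP => v; rewrite !inE eq_sym.
  by exists (f u) => //; apply/setP => v; rewrite !inE eq_sym.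
exists R.
  split=> [x y z|u v /eqP fuv C]; first by rewrite /= eqxx; split=> // /eqP ->.
  by rewrite -imR => /imsetP[j _ ->]; rewrite !fG fuv.
exists (fun i => [set v | f v == i]); split=> // [i j|i j u].
  have [u <-] := fsurj i => /setP/(_ u).
  by rewrite !inE eqxx => /esym/eqP.
by rewrite inE fG => /eqP ->.
Qed.

Lemma card_ord_ltn (r q : nat) : q <= r -> #|[set a : 'I_r | a < q]| = q.
Proof.
move=> le_qr; rewrite -sum1_card -[RHS]card_ord -sum1_card.
by rewrite [RHS](big_ord_widen r (fun=> 1)) //; apply: eq_bigl => a; rewrite inE.
Qed.

(** The set is the preimage of an initial segment under an injective translation. The form [r.+1]
    gives the ordinals their addition modulo [r.+1]. *)
Lemma card_translate_ltn (r q : nat) (a : 'I_r.+1) :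
  q <= r.+1 -> #|[set b : 'I_r.+1 | (b + a)%R < q]| = q.
Proof.
move=> le_qr; rewrite -[RHS](card_ord_ltn le_qr).
rewrite -[RHS](card_preimset _ (GRing.addIr a)).
by apply: eq_card => b; rewrite !inE.
Qed.

Section LiftExists.
Variables (m r : nat) (Q : digraph m).
Hypotheses (Qsym : symmetric_digraph Q) (le_pr : max_multiplicity Q <= r.+1).

Lemma lift_exists : exists G : digraph (m * r.+1),
  [/\ symmetric_digraph G, no_multiple_edges G & is_lift Q G].
Proof.
(* [g] decodes an index below [m * r.+1] as a pair (vertex of [Q], residue), inverting
   [mxvec_index]. *)
have [g fK gK] := curry_mxvec_bij m r.+1.
pose e u v := ((g u).2 + (g v).2)%R < adjmx Q (g v).1 (g u).1.
exists (rel_digraph e); split.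
- by apply: rel_digraph_symmetric => u v; rewrite /e GRing.addrC symmetric_adjmxC.
- exact: rel_digraph_no_multiple_edges.
apply: (@fibration_is_lift _ _ _ _ (fun u => (g u).1)) => [i|j u].
  by exists (mxvec_index i ord0); rewrite (fK (i, ord0)).
rewrite num_edges_from_rel_digraph.
rewrite -[RHS](@card_translate_ltn r _ (g u).2); last first.
  exact: leq_trans (adjmx_le_max_multiplicity _ _ _) le_pr.
(* The residues [b] are carried injectively to the vertices (j, b) of the fibre over [j], where the
   in-neighbours of [u] are counted. *)
rewrite -(card_imset _ (f := mxvec_index j)); last first.
  move=> b c bc; suff [//] : (j, b) = (j, c).
  by rewrite -(fK (j, b)) // -(fK (j, c)) //= bc.
apply: eq_card => v; rewrite !inE; apply/andP/imsetP => [[/eqP <- vu]|[b]].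
  by exists (g v).2; rewrite ?inE // -[LHS]gK; case: (g v).
by rewrite inE => bu ->; rewrite /e (fK (j, b)).
Qed.

End LiftExists.

Theorem theorem2p10 (m : nat) (Q : digraph m)
    (Qsym : symmetric_digraph Q) (Qconn : connected_digraph Q)
    (Qmult : has_multiple_edges Q) :
  (forall (n : nat) (G : digraph n),
      symmetric_digraph G -> no_multiple_edges G -> is_lift Q G ->
      exists r : nat, max_multiplicity Q <= r /\ n = m * r)
  /\
  (forall r : nat, max_multiplicity Q <= r ->
      exists G : digraph (m * r),
        [/\ symmetric_digraph G, no_multiple_edges G & is_lift Q G]).
Proof.
have [i [j qij]] := Qmult; split=> [n G Gsym Gsimple|[|r] le_pr].
(* The vertex [i] witnesses [0 < m]. *)
- exact: lift_size Qsym Qconn Gsym Gsimple (leq_ltn_trans (leq0n i) (ltn_ord i)).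
(* The case [r = 0] would bound an entry greater than 1 by 0. *)
- by have := leq_trans qij (leq_trans (adjmx_le_max_multiplicity Q i j) le_pr).
- exact: lift_exists.
Qed.
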